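(* Let $A$ be an Azumaya algebra of degree $n$ with center $C$. Then for every algebra $R$ there is an affine $C$-scheme $\mathrm{rep}_A(R)$ representing the (contravariant) functor $$\mathrm{Rep}_A(R):\ \mathrm{affine}_C\to\mathrm{Sets},\qquad Z\mapsto \mathrm{Alg}_{\mathbb{C}}\bigl(R,\,A\otimes_C\mathcal{O}(Z)\bigr),$$ where $\mathrm{Alg}_{\mathbb{C}}(-,-)$ denotes the set of $\mathbb{C}$-algebra morphisms.
   Context: All algebras are associative, unital, finitely generated $\mathbb{C}$-algebras; in particular this applies to $R$ and to the commutative algebra $C$. An Azumaya algebra of degree $n$ over a commutative ring $C$ is a $C$-algebra $A$ that is a finitely generated projective $C$-module of constant rank $n^2$ such that $A\otimes_C A^{op}\to \mathrm{End}_C(A)$, $a\otimes b\mapsto (r\mapsto arb)$, is an isomorphism; its center is then $C$. $\mathrm{affine}_C$ is the category of affine $C$-schemes of finite presentation, i.e. the opposite of the category of finitely presented commutative $C$-algebras; $\mathcal{O}(Z)$ is the coordinate ring of $Z$. *)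

(* Defs.v *)
From HB Require Import structures.
From mathcomp Require Import all_boot all_order all_algebra.
From mathcomp Require Import mpoly complex.
From mathcomp Require Import boolp reals.

Set Implicit Arguments.
Unset Strict Implicit.
Unset Printing Implicit Defensive.

Import GRing.Theory.
Local Open Scope ring_scope.
Local Open Scope quotient_scope.

(* A C-algebra is a ring with a ring morphism structmap from C to its        *)
(* center.  MathComp's algType and comAlgType exclude the zero ring, but the *)
(* coordinate ring of the empty scheme is zero and cannot be left out of the *)
(* category of affine C-schemes.                                             *)

HB.mixin Record PzRing_isAlgebraOver (C : pzRingType) A of GRing.PzRing A := {
  structmap : C -> A;
  structmap_zmod_morphism : zmod_morphism structmap;
  structmap_monoid_morphism : monoid_morphism structmap;
  structmap_central : forall (c : C) (x : A), structmap c * x = x * structmap c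
}.

#[short(type="pzAlgType")]
HB.structure Definition PzAlgebra (C : pzRingType) :=
  {A of GRing.PzRing A & PzRing_isAlgebraOver C A}.

#[short(type="comPzAlgType")]
HB.structure Definition ComPzAlgebra (C : pzRingType) :=
  {A of GRing.ComPzRing A & PzRing_isAlgebraOver C A}.

Arguments structmap {C s} : rename.

HB.instance Definition _ (C : pzRingType) (A : pzAlgType C) :=
  GRing.isZmodMorphism.Build C A structmap (@structmap_zmod_morphism C A).
HB.instance Definition _ (C : pzRingType) (A : pzAlgType C) :=
  GRing.isMonoidMorphism.Build C A structmap (@structmap_monoid_morphism C A).

Record algHom (C : pzRingType) (A B : pzAlgType C) := AlgHom {
  hom_fun :> A -> B;
  homD : {morph hom_fun : x y / x + y};
  homM : {morph hom_fun : x y / x * y};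
  hom_structmap : forall c, hom_fun (structmap c) = structmap c
}.

Section AlgHom.
Variable C : pzRingType.
Implicit Types A B : pzAlgType C.

Lemma algHomP A B (f g : algHom A B) : f =1 g -> f = g.
Proof.
case: f g => f fD fM fC [g gD gM gC] /= /funext fg; subst g.
by congr AlgHom; apply: Prop_irrelevance.
Qed.

Lemma hom1 A B (f : algHom A B) : f 1 = 1.
Proof. by rewrite -(rmorph1 structmap) hom_structmap rmorph1. Qed.

Definition algHom_id A : algHom A A :=
  @AlgHom C A A id (fun _ _ => erefl) (fun _ _ => erefl) (fun _ => erefl).

Section Comp.
Variables (A B D : pzAlgType C) (g : algHom B D) (f : algHom A B).

Lemma compD : {morph g \o f : x y / x + y}.
Proof. by move=> x y /=; rewrite !homD. Qed.
Lemma compM : {morph g \o f : x y / x * y}.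
Proof. by move=> x y /=; rewrite !homM. Qed.
Lemma comp_structmap c : (g \o f) (structmap c) = structmap c.
Proof. by rewrite /= !hom_structmap. Qed.

Definition algHom_comp : algHom A D := AlgHom compD compM comp_structmap.
End Comp.

End AlgHom.

Section Converse.
Variables (C : comPzRingType) (A : pzAlgType C).

Let cmap (c : C) : A^c := (structmap c : A).
Fact cmap_zmod : zmod_morphism cmap.
Proof. exact: (raddfB (@structmap C A)). Qed.
Fact cmap_monoid : monoid_morphism cmap.
Proof.
split=> [|c d]; first exact: (rmorph1 (@structmap C A)).
by rewrite /cmap mulrC; apply: (rmorphM (@structmap C A)).
Qed.
Fact cmap_central c (x : A^c) : cmap c * x = x * cmap c.
Proof. exact/esym/(@structmap_central C A). Qed.

HB.instance Definition _ := PzRing_isAlgebraOver.Build C A^c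
  cmap_zmod cmap_monoid cmap_central.
End Converse.

Section RestrictScalars.
Variables (K : comPzRingType) (C : comPzAlgType K) (A : pzAlgType C).

Definition restrict_scalars : Type := A.
HB.instance Definition _ := GRing.PzRing.copy restrict_scalars A.

Let kmap (k : K) : restrict_scalars := @structmap C A (@structmap K C k).
Fact kmap_zmod : zmod_morphism kmap.
Proof. by move=> k l; rewrite /kmap !raddfB. Qed.
Fact kmap_monoid : monoid_morphism kmap.
Proof. by split=> [|k l]; rewrite /kmap ?rmorph1 ?rmorphM. Qed.
Fact kmap_central k (x : restrict_scalars) : kmap k * x = x * kmap k.
Proof. exact: (@structmap_central C A). Qed.

HB.instance Definition _ := PzRing_isAlgebraOver.Build K restrict_scalars
  kmap_zmod kmap_monoid kmap_central.
End RestrictScalars.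

Section LmodOf.
Variables (C : comPzRingType) (A : pzAlgType C).

Definition lmod_of : Type := A.
HB.instance Definition _ := GRing.Zmodule.copy lmod_of A.

Let lscale (c : C) (x : lmod_of) : lmod_of := structmap c * (x : A).
Fact lscaleA c d x : lscale c (lscale d x) = lscale (c * d) x.
Proof. by rewrite /lscale mulrA rmorphM. Qed.
Fact lscale1 : left_id 1 lscale.
Proof. by move=> x; rewrite /lscale rmorph1 mul1r. Qed.
Fact lscaleDr : right_distributive lscale +%R.
Proof. by move=> c x y; rewrite /lscale mulrDr. Qed.
Fact lscaleDl x : {morph lscale^~ x : c d / c + d}.
Proof. by move=> c d; rewrite /lscale raddfD mulrDl. Qed.

HB.instance Definition _ := GRing.Zmodule_isLmodule.Build C lmod_of
  lscaleA lscale1 lscaleDr lscaleDl.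
End LmodOf.

(* Tensor product of C-algebras: formal finite sums of pairs (a, b), modulo  *)
(* the congruence generated by C-bilinearity.                                *)

Section Tensor.
Variables (C : comPzRingType) (A B : pzAlgType C).
Implicit Types (s t : seq (A * B)) (a : A) (b : B) (c : C).

Inductive tensor_rel : seq (A * B) -> seq (A * B) -> Prop :=
| TensorRefl s : tensor_rel s s
| TensorSym s t : tensor_rel s t -> tensor_rel t s
| TensorTrans s t u : tensor_rel s t -> tensor_rel t u -> tensor_rel s u
| TensorCat s s' t t' :
    tensor_rel s s' -> tensor_rel t t' -> tensor_rel (s ++ t) (s' ++ t')
| TensorCatC s t : tensor_rel (s ++ t) (t ++ s)
| Tensor0l b : tensor_rel [:: (0, b)] [::]
| TensorDl a a' b : tensor_rel [:: (a + a', b)] [:: (a, b); (a', b)]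
| TensorDr a b b' : tensor_rel [:: (a, b + b')] [:: (a, b); (a, b')]
| TensorZ c a b : tensor_rel [:: (structmap c * a, b)] [:: (a, structmap c * b)].

Definition tensor_eqv s t := `[< tensor_rel s t >].

Fact tensor_eqv_refl : reflexive tensor_eqv.
Proof. by move=> s; apply/asboolP; constructor. Qed.
Fact tensor_eqv_sym : ssrbool.symmetric tensor_eqv.
Proof. by move=> s t; apply/asboolP/asboolP => h; apply: TensorSym. Qed.
Fact tensor_eqv_trans : transitive tensor_eqv.
Proof. by move=> t s u /asboolP h /asboolP k; apply/asboolP/(TensorTrans h). Qed.

Canonical tensor_equiv :=
  EquivRel tensor_eqv tensor_eqv_refl tensor_eqv_sym tensor_eqv_trans.

Definition tensor := {eq_quot tensor_equiv}.
HB.instance Definition _ := Choice.on tensor.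
HB.instance Definition _ := EqQuotient.on tensor.

Definition tens_of s : tensor := \pi_tensor s.
Definition tens a b : tensor := tens_of [:: (a, b)].

Lemma tens_ofP s t : tens_of s = tens_of t <-> tensor_rel s t.
Proof.
split=> [/eqquotP/asboolP //|h].
by apply/eqquotP/asboolP.
Qed.

Lemma tens_ofK s : tensor_rel (repr (tens_of s)) s.
Proof. by apply/tens_ofP; rewrite /tens_of reprK. Qed.

Definition tens_add (x y : tensor) : tensor := tens_of (repr x ++ repr y).
Definition tens_opp (x : tensor) : tensor :=
  tens_of [seq (- p.1, p.2) | p <- repr x].

Lemma tens_ofD s t : tens_add (tens_of s) (tens_of t) = tens_of (s ++ t).
Proof. by apply/tens_ofP/TensorCat; apply: tens_ofK. Qed.

Lemma tensE x : x = tens_of (repr x).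
Proof. by rewrite /tens_of reprK. Qed.

Fact tens_addA : associative tens_add.
Proof. by move=> x y z; rewrite (tensE x) (tensE y) (tensE z) !tens_ofD catA. Qed.
Fact tens_addC : commutative tens_add.
Proof. by move=> x y; apply/tens_ofP/TensorCatC. Qed.
Fact tens_add0 : left_id (tens_of [::]) tens_add.
Proof. by move=> x; rewrite [x]tensE tens_ofD. Qed.
Fact tens_addN : left_inverse (tens_of [::]) tens_opp tens_add.
Proof.
move=> x; rewrite {2}[x]tensE /tens_opp tens_ofD; apply/tens_ofP.
elim: (repr x) => [|[a b] s IH] /=; first exact: TensorRefl.
have hmid : tensor_rel ([:: (- a, b)] ++ ([seq (- p.1, p.2) | p <- s] ++
  ([:: (a, b)] ++ s))) ([:: (- a, b)] ++ ([:: (a, b)] ++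
  ([seq (- p.1, p.2) | p <- s] ++ s))).
  apply: TensorCat; first exact: TensorRefl.
  by rewrite !catA; apply: TensorCat; [apply: TensorCatC|apply: TensorRefl].
apply: (TensorTrans hmid); rewrite catA -[[::]]/([::] ++ [::]).
apply: TensorCat => //; apply: (@TensorTrans _ [:: (- a + a, b)]).
  by apply/TensorSym/TensorDl.
by rewrite addNr; apply: Tensor0l.
Qed.

HB.instance Definition _ :=
  GRing.isZmodule.Build tensor tens_addA tens_addC tens_add0 tens_addN.

Lemma tens_of_cat s t : tens_of (s ++ t) = tens_of s + tens_of t.
Proof. by rewrite -tens_ofD. Qed.

Lemma tens_of_sum s : tens_of s = \sum_(p <- s) tens p.1 p.2.
Proof.
elim: s => [|[a b] s IH]; first by rewrite big_nil.
by rewrite big_cons -IH -tens_of_cat.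
Qed.

Lemma tensDl a a' b : tens (a + a') b = tens a b + tens a' b.
Proof. by rewrite -tens_of_cat; apply/tens_ofP/TensorDl. Qed.
Lemma tensDr a b b' : tens a (b + b') = tens a b + tens a b'.
Proof. by rewrite -tens_of_cat; apply/tens_ofP/TensorDr. Qed.
Lemma tensZ c a b : tens (structmap c * a) b = tens a (structmap c * b).
Proof. exact/tens_ofP/TensorZ. Qed.

Lemma tens_ind (P : tensor -> Prop) :
  P 0 -> (forall a b x, P x -> P (tens a b + x)) -> forall x, P x.
Proof.
move=> P0 PD x; rewrite [x]tensE tens_of_sum.
elim: (repr x) => [|p s IH]; first by rewrite big_nil.
by rewrite big_cons; apply: PD.
Qed.

(* tens_lift f is the additive map sending tens a b to f a b; it is          *)
(* meaningful when f is balanced.                                            *)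
Definition balanced (M : zmodType) (f : A -> B -> M) :=
  [/\ forall b, {morph f^~ b : a a' / a + a'},
      forall a, {morph f a : b b' / b + b'}
    & forall c a b, f (structmap c * a) b = f a (structmap c * b)].

Definition tens_lift (M : zmodType) (f : A -> B -> M) (x : tensor) : M :=
  \sum_(p <- repr x) f p.1 p.2.

Section Lift.
Variables (M : zmodType) (f : A -> B -> M) (hf : balanced f).

Lemma tensor_rel_sum s t : tensor_rel s t ->
  \sum_(p <- s) f p.1 p.2 = \sum_(p <- t) f p.1 p.2.
Proof.
have [fDl fDr fZ] := hf; elim=> {s t} //.
- by move=> ? ? ? _ -> _ ->.
- by move=> ? ? ? ? _ h _ k; rewrite !big_cat /= h k.
- by move=> ? ?; rewrite !big_cat /= addrC.
- move=> b; rewrite big_seq1 big_nil /=.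
  by apply: (addrI (f 0 b)); rewrite -fDl !addr0.
- by move=> *; rewrite !big_cons !big_nil /= !addr0 fDl.
- by move=> *; rewrite !big_cons !big_nil /= !addr0 fDr.
- by move=> *; rewrite !big_seq1 /= fZ.
Qed.

Lemma tens_lift_of s : tens_lift f (tens_of s) = \sum_(p <- s) f p.1 p.2.
Proof. exact/tensor_rel_sum/tens_ofK. Qed.

Lemma tens_lift_tens a b : tens_lift f (tens a b) = f a b.
Proof. by rewrite tens_lift_of big_seq1. Qed.

Lemma tens_lift0 : tens_lift f 0 = 0.
Proof. by rewrite tens_lift_of big_nil. Qed.

Lemma tens_liftD : {morph tens_lift f : x y / x + y}.
Proof.
move=> x y; rewrite [x]tensE [y]tensE -tens_of_cat.
by rewrite !tens_lift_of big_cat.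
Qed.
End Lift.

Lemma eq_tens_lift (M : zmodType) (f g : A -> B -> M) x :
  f =2 g -> tens_lift f x = tens_lift g x.
Proof. by move=> fg; apply: eq_bigr => p _; apply: fg. Qed.

Lemma tens_liftDf (M : zmodType) (f g : A -> B -> M) x :
  tens_lift (fun a b => f a b + g a b) x = tens_lift f x + tens_lift g x.
Proof. exact: big_split. Qed.

End Tensor.

Section TensorAlgebra.
Variables (C : comPzRingType) (A B : pzAlgType C).
Local Notation T := (tensor A B).
Implicit Types (a : A) (b : B) (x y z : T).

Lemma balanced_mulr a b : balanced (fun a' b' => tens (a * a') (b * b') : T).
Proof.
split=> [b' a' a''|a' b' b''|c a' b'].
- by rewrite mulrDr tensDl.
- by rewrite mulrDr tensDr.
- by rewrite mulrA -!structmap_central -mulrA tensZ mulrA structmap_central mulrA.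
Qed.

Definition tens_mull a b y : T :=
  tens_lift (fun a' b' => tens (a * a') (b * b')) y.

Lemma balanced_mull y : balanced (fun a b => tens_mull a b y).
Proof.
split=> [b a a'|a b b'|c a b].
- rewrite -tens_liftDf; apply: eq_tens_lift => ? ?.
  by rewrite mulrDl tensDl.
- rewrite -tens_liftDf; apply: eq_tens_lift => ? ?.
  by rewrite mulrDl tensDr.
- apply: eq_tens_lift => ? ?.
  by rewrite -mulrA tensZ mulrA.
Qed.

Definition tens_mul x y : T := tens_lift (fun a b => tens_mull a b y) x.

Lemma tens_mul_tens a b a' b' :
  tens_mul (tens a b) (tens a' b') = tens (a * a') (b * b').
Proof.
rewrite /tens_mul (tens_lift_tens (balanced_mull _)).
exact: (tens_lift_tens (balanced_mulr _ _)).
Qed.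

Fact tens_mulDl : left_distributive tens_mul +%R.
Proof. by move=> x y z; apply: (tens_liftD (balanced_mull z)). Qed.
Fact tens_mulDr : right_distributive tens_mul +%R.
Proof.
move=> x y z; rewrite -tens_liftDf; apply: eq_tens_lift => a b.
exact: (tens_liftD (balanced_mulr a b)).
Qed.
Fact tens_mul0l x : tens_mul 0 x = 0.
Proof. exact: (tens_lift0 (balanced_mull x)). Qed.
Fact tens_mul0r x : tens_mul x 0 = 0.
Proof.
by apply: (addrI (tens_mul x 0)); rewrite -tens_mulDr !addr0.
Qed.

Fact tens_mulA : associative tens_mul.
Proof.
move=> x y z; elim/tens_ind: x => [|a b x IHx]; first by rewrite !tens_mul0l.
rewrite !tens_mulDl IHx; congr (_ + _); clear x IHx.
elim/tens_ind: y => [|a' b' y IHy]; first by rewrite !(tens_mul0l, tens_mul0r).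
rewrite !(tens_mulDl, tens_mulDr) IHy; congr (_ + _); clear y IHy.
elim/tens_ind: z => [|a'' b'' z IHz]; first by rewrite !tens_mul0r.
by rewrite !tens_mulDr IHz !tens_mul_tens !mulrA.
Qed.

Fact tens_mul1l : left_id (tens 1 1) tens_mul.
Proof.
elim/tens_ind => [|a b x IH]; first by rewrite tens_mul0r.
by rewrite tens_mulDr IH tens_mul_tens !mul1r.
Qed.
Fact tens_mul1r : right_id (tens 1 1) tens_mul.
Proof.
elim/tens_ind => [|a b x IH]; first by rewrite tens_mul0l.
by rewrite tens_mulDl IH tens_mul_tens !mulr1.
Qed.

HB.instance Definition _ := GRing.Zmodule_isPzRing.Build T
  tens_mulA tens_mul1l tens_mul1r tens_mulDl tens_mulDr.

Lemma mul_tens a b a' b' :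
  (tens a b : T) * tens a' b' = tens (a * a') (b * b').
Proof. exact: tens_mul_tens. Qed.

Let tmap (c : C) : T := tens (structmap c) 1.
Fact tmap_zmod : zmod_morphism tmap.
Proof.
move=> c d; apply: (addIr (tmap d)); rewrite subrK /tmap -tensDl.
by rewrite -raddfD subrK.
Qed.
Fact tmap_monoid : monoid_morphism tmap.
Proof.
split=> [|c d]; first by rewrite /tmap rmorph1.
by rewrite /tmap mul_tens mulr1 rmorphM.
Qed.
Fact tmap_central c x : tmap c * x = x * tmap c.
Proof.
elim/tens_ind: x => [|a b x IH]; first by rewrite mul0r mulr0.
by rewrite mulrDl mulrDr IH !mul_tens mul1r mulr1 structmap_central.
Qed.

HB.instance Definition _ := PzRing_isAlgebraOver.Build C T
  tmap_zmod tmap_monoid tmap_central.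

End TensorAlgebra.

(* The algebra morphism id (x) f : A (x) B -> A (x) B'. *)
Section TensorMap.
Variables (C : comPzRingType) (A B B' : pzAlgType C) (f : algHom B B').

Definition tens_map (x : tensor A B) : tensor A B' :=
  tens_lift (fun a b => tens a (f b)) x.

Lemma balanced_map : balanced (fun (a : A) b => tens a (f b)).
Proof.
split=> [b a a'|a b b'|c a b]; first by rewrite tensDl.
  by rewrite homD tensDr.
by rewrite tensZ homM hom_structmap.
Qed.

Lemma tens_map_tens a b : tens_map (tens a b) = tens a (f b).
Proof. exact: (tens_lift_tens balanced_map). Qed.
Lemma tens_mapD : {morph tens_map : x y / x + y}.
Proof. exact: (tens_liftD balanced_map). Qed.
Lemma tens_map0 : tens_map 0 = 0.
Proof. exact: (tens_lift0 balanced_map). Qed.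

Lemma tens_mapM : {morph tens_map : x y / x * y}.
Proof.
move=> x y.
elim/tens_ind: x => [|a b x IHx]; first by rewrite !(mul0r, tens_map0).
rewrite !(mulrDl, tens_mapD) IHx; congr (_ + _).
clear x IHx.
elim/tens_ind: y => [|a' b' y IHy]; first by rewrite !(mulr0, tens_map0).
by rewrite !(mulrDr, tens_mapD) IHy !(mul_tens, tens_map_tens) homM.
Qed.

Lemma tens_map_structmap c : tens_map (structmap c) = structmap c.
Proof. by rewrite tens_map_tens hom1. Qed.

Definition tens_hom : algHom (tensor A B) (tensor A B') :=
  AlgHom tens_mapD tens_mapM tens_map_structmap.

End TensorMap.

Definition subalgebra (C : comPzRingType) (A : pzAlgType C) (P : A -> Prop) :=
  [/\ forall c, P (structmap c),
      forall x y, P x -> P y -> P (x + y)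
    & forall x y, P x -> P y -> P (x * y)].

Definition finitely_generated (C : comPzRingType) (A : pzAlgType C) :=
  exists s : seq A, forall P : A -> Prop,
    subalgebra P -> (forall x, x \in s -> P x) -> forall x, P x.

(* {mpoly C[k]} requires 1 != 0 in C. *)
Section NonzeroRing.
Variables (C : comPzRingType) (C_neq0 : 1 != 0 :> C).
Definition nonzero_ring of 1 != 0 :> C : Type := C.
HB.instance Definition _ := GRing.ComPzRing.copy (nonzero_ring C_neq0) C.
HB.instance Definition _ :=
  GRing.PzSemiRing_isNonZero.Build (nonzero_ring C_neq0) C_neq0.
End NonzeroRing.

Definition mpoly_eval (C : comPzRingType) (C_neq0 : 1 != 0 :> C)
    (D : comPzAlgType C) k (d : 'I_k -> D)
    (p : {mpoly (nonzero_ring C_neq0)[k]}) : D :=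
  \sum_(m <- msupp p) structmap (p@_m : C) * \prod_(i < k) d i ^+ m i.

(* D is isomorphic to C[X_1, ..., X_k] / (r_1, ..., r_l).  If C is the zero  *)
(* ring, then so is D, and nothing is required.                              *)
Definition finitely_presented (C : comPzRingType) (D : comPzAlgType C) :=
  forall C_neq0 : 1 != 0 :> C,
  exists (k : nat) (d : 'I_k -> D) (l : nat)
         (r : 'I_l -> {mpoly (nonzero_ring C_neq0)[k]}),
    (forall x, exists p : {mpoly (nonzero_ring C_neq0)[k]}, x = mpoly_eval d p) /\
    (forall p, mpoly_eval d p = 0 <->
       exists q : 'I_l -> {mpoly (nonzero_ring C_neq0)[k]},
         p = \sum_(j < l) q j * r j).

Definition is_basis (L : comPzRingType) (N : lmodType L) k (b : 'I_k -> N) :=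
  forall x, exists! c : {ffun 'I_k -> L}, x = \sum_(i < k) c i *: b i.

Definition module_finite (C : comPzRingType) (M : lmodType C) :=
  exists (k : nat) (b : 'I_k -> M),
    forall x, exists c : 'I_k -> C, x = \sum_(i < k) c i *: b i.

Definition projective (C : comPzRingType) (P : lmodType C) :=
  forall (M N : lmodType C) (g : {linear M -> N}) (f : {linear P -> N}),
    (forall y, exists x, g x = y) -> exists h : {linear P -> M}, g \o h =1 f.

Record prime_ideal (C : comPzRingType) (P : C -> Prop) : Prop := PrimeIdeal {
  prime_ideal0 : P 0;
  prime_idealD : forall x y, P x -> P y -> P (x + y);
  prime_idealM : forall x y, P y -> P (x * y);
  prime_ideal1 : ~ P 1;
  prime_ideal_prime : forall x y, P (x * y) -> P x \/ P y
}.

(* phi : C -> L exhibits the ring L as the localization C_P, and             *)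
(* psi : M -> N exhibits the L-module N as the localization M_P.             *)
Record localization_at (C : comPzRingType) (M : lmodType C) (P : C -> Prop)
    (L : comPzRingType) (N : lmodType L)
    (phi : {rmorphism C -> L}) (psi : {additive M -> N}) : Prop :=
  LocalizationAt {
  loc_unit : forall s, ~ P s -> exists u, phi s * u = 1;
  loc_frac : forall x, exists c s, ~ P s /\ phi s * x = phi c;
  loc_ker : forall c, phi c = 0 -> exists2 s, ~ P s & s * c = 0;
  loc_semilinear : forall c m, psi (c *: m) = phi c *: psi m;
  loc_mod_frac : forall x, exists m s, ~ P s /\ phi s *: x = psi m;
  loc_mod_ker : forall m, psi m = 0 -> exists2 s, ~ P s & s *: m = 0
}.

Definition constant_rank (C : comPzRingType) (M : lmodType C) (r : nat) :=
  forall P : C -> Prop, prime_ideal P ->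
  exists (L : comPzRingType) (N : lmodType L)
         (phi : {rmorphism C -> L}) (psi : {additive M -> N}),
    localization_at P phi psi /\ exists b : 'I_r -> N, is_basis b.

Section Azumaya.
Variables (C : comPzRingType) (A : pzAlgType C).

Lemma balanced_sandwich (r : A) :
  balanced (fun (a : A) (b : A^c) => a * r * (b : A)).
Proof.
split=> [b a a'|a b b'|c a b]; first by rewrite !mulrDl.
  by rewrite mulrDr.
by rewrite -!mulrA structmap_central -!mulrA; congr (_ * (_ * _));
   rewrite -structmap_central.
Qed.

Definition sandwich (t : tensor A A^c) (r : lmod_of A) : lmod_of A :=
  tens_lift (fun (a : A) (b : A^c) => a * (r : A) * (b : A)) t.

Lemma sandwich0 r : sandwich 0 r = 0.
Proof. exact: (tens_lift0 (balanced_sandwich _)). Qed.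
Lemma sandwichD t u r : sandwich (t + u) r = sandwich t r + sandwich u r.
Proof. exact: (tens_liftD (balanced_sandwich _)). Qed.
Lemma sandwich_tens (a : A) (b : A^c) (r : A) :
  sandwich (tens a b) r = a * r * (b : A).
Proof. exact: (tens_lift_tens (balanced_sandwich _)). Qed.

Lemma sandwich_linear t : linear (sandwich t).
Proof.
move=> c r r'; elim/tens_ind: t => [|a b t IH].
  by rewrite !sandwich0 scaler0 addr0.
rewrite !sandwichD IH !sandwich_tens scalerDr addrACA.
congr (_ + _); rewrite mulrDr mulrDl; congr (_ + _).
by rewrite /GRing.scale /= !mulrA -structmap_central.
Qed.

(* Together with sandwichD, the next two lemmas say that t |-> sandwich t is *)
(* a morphism of C-algebras to End_C(A).                                     *)
Lemma sandwichM t u r : sandwich (t * u) r = sandwich t (sandwich u r).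
Proof.
elim/tens_ind: t => [|a b t IH]; first by rewrite mul0r !sandwich0.
rewrite mulrDl !sandwichD IH sandwich_tens; congr (_ + _); clear t IH.
elim/tens_ind: u => [|a' b' u IH].
  by rewrite mulr0 !sandwich0 mulr0 mul0r.
rewrite mulrDr !sandwichD IH mulrDr mulrDl mul_tens !sandwich_tens.
by congr (_ + _); rewrite !mulrA.
Qed.

Lemma sandwich_structmap c r : sandwich (structmap c) r = c *: r.
Proof. by rewrite sandwich_tens mulr1. Qed.

HB.instance Definition _ t := GRing.isLinear.Build C (lmod_of A) (lmod_of A)
  *:%R (sandwich t) (sandwich_linear t).

Definition sandwich_map : tensor A A^c -> {linear lmod_of A -> lmod_of A} :=
  fun t => sandwich t.

Definition azumaya (n : nat) :=
  [/\ module_finite (lmod_of A), projective (lmod_of A),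
      constant_rank (lmod_of A) (n ^ 2) & bijective sandwich_map].

End Azumaya.

Record affine (C : comPzRingType) := Affine {
  coord_ring : comPzAlgType C;
  coord_ring_fp : finitely_presented coord_ring
}.

Notation "''O' ( Z )" := (coord_ring Z) (at level 8, format "''O' ( Z )").

Section AffineSchemes.
Variable C : comPzRingType.

Definition affineHom (Z Y : affine C) := algHom 'O(Y) 'O(Z).

Definition affine_id (Z : affine C) : affineHom Z Z := algHom_id 'O(Z).

Definition affine_comp (Z Y X : affine C) (g : affineHom Y X)
  (f : affineHom Z Y) : affineHom Z X := algHom_comp f g.

Record presheaf := Presheaf {
  presheaf_obj :> affine C -> Type;
  presheaf_map : forall Z Y : affine C,
    affineHom Z Y -> presheaf_obj Y -> presheaf_obj Z;
  presheaf_id : forall (Z : affine C) (x : presheaf_obj Z),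
    presheaf_map (affine_id Z) x = x;
  presheaf_comp : forall (Z Y X : affine C) (g : affineHom Y X)
    (f : affineHom Z Y) (x : presheaf_obj X),
    presheaf_map (affine_comp g f) x = presheaf_map f (presheaf_map g x)
}.

Definition represents (X : affine C) (F : presheaf) :=
  exists eta : forall Z : affine C, affineHom Z X -> F Z,
    (forall Z, bijective (eta Z)) /\
    (forall (Z Y : affine C) (f : affineHom Z Y) (g : affineHom Y X),
       eta Z (affine_comp g f) = presheaf_map f (eta Y g)).

End AffineSchemes.

(* Rep_A(R), with K for the base field and A (x)_C O(Z) viewed as a          *)
(* K-algebra through C.                                                      *)
Section Rep.
Variables (K : comPzRingType) (C : comPzAlgType K).
Variables (A : pzAlgType C) (R : pzAlgType K).

Definition Rep_obj (Z : affine C) : Type :=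
  algHom R (restrict_scalars (tensor A 'O(Z))).

Section RestrictHom.
Variables (B B' : pzAlgType C) (f : algHom B B').

Lemma restrict_structmap (k : K) :
  f (structmap k : restrict_scalars B) = (structmap k : restrict_scalars B').
Proof. exact: hom_structmap. Qed.

Definition restrict_hom : algHom (restrict_scalars B) (restrict_scalars B') :=
  @AlgHom K (restrict_scalars B) (restrict_scalars B') f
    (homD f) (homM f) restrict_structmap.
End RestrictHom.

Definition Rep_map (Z Y : affine C) (f : affineHom Z Y) (h : Rep_obj Y) :
  Rep_obj Z := algHom_comp (restrict_hom (tens_hom A f)) h.

Lemma Rep_map_id (Z : affine C) (h : Rep_obj Z) : Rep_map (affine_id Z) h = h.
Proof.
apply: algHomP => x /=; elim/tens_ind: (h x) => [|a b y IH].
  exact: tens_map0.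
by rewrite tens_mapD IH tens_map_tens.
Qed.

Lemma Rep_map_comp (Z Y X : affine C) (g : affineHom Y X) (f : affineHom Z Y)
    (h : Rep_obj X) :
  Rep_map (affine_comp g f) h = Rep_map f (Rep_map g h).
Proof.
apply: algHomP => x /=; elim/tens_ind: (h x) => [|a b y IH].
  by rewrite !tens_map0.
by rewrite !tens_mapD IH !tens_map_tens.
Qed.

Definition Rep : presheaf C := Presheaf Rep_map_id Rep_map_comp.

End Rep.

(* Main.v *)
Require Import Defs.
From HB Require Import structures.
From mathcomp Require Import all_boot all_order all_algebra.
From mathcomp Require Import mpoly complex boolp reals.

(* A is finitely generated projective over C, so it has a dual basis         *)
(* (a_i, f_i), and an element of A (x) D is determined by its coordinates in *)
(* D.  Let r_1, ..., r_m generate R.  The universal morphism sends r_j to    *)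
(* sum_i a_i (x) x_ji over C[x_ji] / I, where I is the ideal making the a_i- *)
(* coordinate of this sum equal to x_ji and making the sums satisfy all the  *)
(* relations between the r_j.  There may be infinitely many relations, but C *)
(* is finitely generated over a field, so I is finitely generated by         *)
(* Hilbert's basis theorem.                                                  *)

Set Implicit Arguments.
Unset Strict Implicit.
Unset Printing Implicit Defensive.

Import GRing.Theory.
Local Open Scope ring_scope.
Local Open Scope quotient_scope.
Local Open Scope complex_scope.

(** * Ideals and Hilbert's basis theorem *)

(** By Yoneda it is enough to find an affine scheme [X] with a universal point: a morphism from R to
    A (x) O(X) from which every point over every Z arises by a unique base change
    ([represents_universal]). A dual basis presents A as a direct summand of the free module C^N, so
    a point over D amounts to an m by N matrix over D, the coordinates of the images of the m
    generators of R ([tens_coord], [dual_coord_inj]). The matrices that occur are cut out by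
    polynomial equations over C: the rows must lie in the summand, and the relations of R must hold.
    Coordinates commute with base change ([dual_coord_map]), so the same equations serve every D,
    and the polynomial ring modulo these equations has the universal property ([rep_represents]). It
    lies in the category because the polynomial ring over C is noetherian ([mpoly_noetherian],
    [quot_finitely_presented]). *)

Section Ideals.
Variable R : comPzRingType.
Implicit Types (I J S : R -> Prop) (s : seq R).

Definition is_ideal I :=
  [/\ I 0, forall x y, I x -> I y -> I (x + y) & forall x y, I y -> I (x * y)].

(** Encoded as the intersection of all ideals containing [S]: membership is exploited by choosing a
    suitable test ideal [J]. *)
Definition ideal_gen S x :=
  forall J, is_ideal J -> (forall y, S y -> J y) -> J x.

Lemma ideal_gen_ideal S : is_ideal (ideal_gen S).
Proof.
split=> [J [] //|x y hx hy J hJ hS|x y hy J hJ hS].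
  by have [_ JD _] := hJ; apply: JD; [apply: hx|apply: hy].
by have [_ _ JM] := hJ; apply: JM; apply: hy.
Qed.

Lemma ideal_gen_sub S x : S x -> ideal_gen S x.
Proof. by move=> Sx J _; apply. Qed.

Lemma idealB I x y : is_ideal I -> I x -> I y -> I (x - y).
Proof.
by move=> [_ ID IM] Ix Iy; apply: ID => //; rewrite -mulN1r; apply: IM.
Qed.

Definition noetherian := forall I, is_ideal I ->
  exists s, (forall y, y \in s -> I y) /\
    forall x, I x -> ideal_gen (fun y => y \in s) x.

(** The linear combinations of [s] form an ideal containing [s], hence a legitimate test ideal. *)
Lemma ideal_gen_seq s x : ideal_gen (fun y => y \in s) x ->
  exists q : 'I_(size s) -> R, x = \sum_j q j * s`_j.
Proof.
move=> /(_ (fun x => exists q : 'I_(size s) -> R, x = \sum_j q j * s`_j)).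
apply=> [|y ys]; first split.
- by exists (fun=> 0); rewrite big1 // => j _; rewrite mul0r.
- move=> _ _ [q ->] [q' ->]; exists (fun j => q j + q' j).
  by rewrite -big_split; apply: eq_bigr => j _; rewrite mulrDl.
- move=> c _ [q ->]; exists (fun j => c * q j).
  by rewrite mulr_sumr; apply: eq_bigr => j _; rewrite mulrA.
have lt_ys : (index y s < size s)%N by rewrite index_mem.
exists (fun j => (j == Ordinal lt_ys)%:R).
rewrite (bigD1 (Ordinal lt_ys)) //= eqxx mul1r nth_index // big1 ?addr0 //.
by move=> j /negPf ->; rewrite mul0r.
Qed.

End Ideals.

(** Generators of the preimage of an ideal map to generators of the ideal, by surjectivity. *)
Lemma noetherian_image (R S : comPzRingType) (f : {rmorphism R -> S}) :
  (forall y, exists x, f x = y) -> noetherian R -> noetherian S.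
Proof.
move=> f_surj nR I hI; have [I0 ID IM] := hI.
have hfI : is_ideal (fun x => I (f x)).
  split=> [|x y|x y]; first by rewrite rmorph0.
    by rewrite rmorphD; apply: ID.
  by rewrite rmorphM; apply: IM.
have [s [sI Is]] := nR _ hfI.
exists [seq f x | x <- s]; split=> [_ /mapP[x xs ->]|y]; first exact: sI.
have [x <-] := f_surj y; move=> /Is xs J hJ sJ; apply: (xs (fun x => J (f x))).
  have [J0 JD JM] := hJ; split=> [|? ?|? ?]; first by rewrite rmorph0.
    by rewrite rmorphD; apply: JD.
  by rewrite rmorphM; apply: JM.
by move=> z zs; apply/sJ/map_f.
Qed.

Lemma field_noetherian (F : fieldType) : noetherian F.
Proof.
move=> I hI; have [I0 _ IM] := hI.
have [[x [Ix x0]]|noI] := pselect (exists x, I x /\ x != 0).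
  exists [:: x]; split=> [y|y _ J [_ _ JM] xJ]; first by rewrite inE => /eqP ->.
  by rewrite -(divfK x0 y); apply: JM; apply: xJ; rewrite inE.
exists [::]; split=> // x Ix J [J0 _ _] _.
by have [-> //|x0] := eqVneq x 0; case: noI; exists x.
Qed.

(** Finite choice; it turns a list of leading coefficients into a list of polynomials having
    them. *)
Lemma seq_lift (T U : eqType) (Q : T -> U -> Prop) (s : seq T) :
  (forall c, c \in s -> exists g, Q c g) ->
  exists gs : seq U, (forall g, g \in gs -> exists2 c, c \in s & Q c g) /\
    forall c, c \in s -> exists2 g, g \in gs & Q c g.
Proof.
elim: s => [|c s IH] h; first by exists [::].
have [g Qcg] := h c (mem_head _ _).
have [d ds|gs [gs1 gs2]] := IH; first by apply: h; rewrite inE ds orbT.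
exists (g :: gs); split=> [g'|d]; rewrite inE => /predU1P[->|].
- by exists c; rewrite ?mem_head.
- by move=> /gs1[d ds Qd]; exists d => //; rewrite inE ds orbT.
- by exists g; rewrite ?mem_head.
- by move=> /gs2[g' g'gs Qd]; exists g' => //; rewrite inE g'gs orbT.
Qed.

(** * Hilbert's basis theorem, in one variable and then in several *)

Section HilbertBasis.
Variables (R : comNzRingType) (nR : noetherian R).
Implicit Types (I : {poly R} -> Prop) (f g : {poly R}).

(** The size bound allows [g] of degree below [n], with [c] equal to 0; this is what makes these
    coefficients an ideal. *)
Definition top_coef I n c := exists g, [/\ I g, (size g <= n.+1)%N & g`_n = c].

Lemma top_coef_ideal I n : is_ideal I -> is_ideal (top_coef I n).
Proof.
move=> [I0 ID IM]; split.
- by exists 0; rewrite size_poly0 coef0.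
- move=> _ _ [g [Ig sg <-]] [h [Ih sh <-]]; exists (g + h).
  rewrite coefD; split=> //; first exact: ID.
  by apply: (leq_trans (size_polyD _ _)); rewrite geq_max sg.
- move=> c _ [g [Ig sg <-]]; exists (c%:P * g).
  rewrite coefCM; split=> //; first exact: IM.
  by rewrite mul_polyC (leq_trans (size_scale_leq _ _)).
Qed.

Lemma top_coef_le I m n c : is_ideal I -> (m <= n)%N ->
  top_coef I m c -> top_coef I n c.
Proof.
move=> [_ _ IM] le_mn [g [Ig sg <-]]; exists ('X^(n - m) * g).
rewrite coefXnM ltnNge leq_subr /= subKn //; split=> //; first exact: IM.
apply: (leq_trans (size_polyMleq _ _)); rewrite size_polyXn addSn /=.
by rewrite -[in leqRHS](subnK le_mn) -addnS leq_add2l.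
Qed.

Lemma size_sub_top f g n : (size f <= n.+1)%N -> (size g <= n.+1)%N ->
  f`_n = g`_n -> (size (f - g)%R <= n)%N.
Proof.
move=> sf sg eq_fg; apply/leq_sizeP=> j.
rewrite leq_eqVlt => /predU1P[<-|lt_nj].
  by rewrite coefB eq_fg subrr.
by rewrite coefB !nth_default ?subrr //; apply: leq_trans lt_nj.
Qed.

(** Induction on [n]: adjoin polynomials lifting generators of the ideal of degree-[n] top
    coefficients. A combination of them cancels the top coefficient of [f], which lowers its
    size. *)
Lemma ideal_bounded_gen I n : is_ideal I ->
  exists s : seq {poly R}, (forall g, g \in s -> I g) /\
    forall f, I f -> (size f <= n)%N -> ideal_gen (fun g => g \in s) f.
Proof.
move=> hI; elim: n => [|n [s [sI Is]]].
  exists [::]; split=> // f _; rewrite leqn0 size_poly_eq0 => /eqP ->.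
  by move=> J [].
have [cs [csI Ics]] := nR (top_coef_ideal n hI).
have [gs [gsI csgs]] := seq_lift csI.
exists (s ++ gs); split=> [g|f If sf J hJ sJ].
  by rewrite mem_cat => /orP[/sI //|/gsI[c _ []]].
(* The test ideal consists of the top coefficients of the intersection of [J] and [I]. It contains
   the generators [cs], hence the top coefficient of [f]. *)
have [g [[Jg Ig] sg fg]] : top_coef (fun g => J g /\ I g) n f`_n.
  apply: (Ics f`_n); first by exists f.
    apply: top_coef_ideal; have [I0 ID IM] := hI; have [J0 JD JM] := hJ.
    by split=> // [x y [? ?] [? ?]|x y [? ?]]; split; auto.
  move=> c /csgs[g ggs [Ig sg gc]]; exists g; split=> //; split=> //.
  by apply: sJ; rewrite mem_cat ggs orbT.
rewrite -(subrK g f); have [_ JD _] := hJ; apply: JD => //.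
apply: (Is (f - g)); rewrite ?size_sub_top //; first exact: idealB.
by move=> h hs; apply: sJ; rewrite mem_cat hs.
Qed.

(** The top coefficients of [I] in all degrees together form a finitely generated ideal, whose
    generators all occur in one degree [N]. Their lifts reduce everything of degree at least [N];
    [ideal_bounded_gen] handles the rest. *)
Lemma poly_noetherian : noetherian {poly R}.
Proof.
move=> I hI; have [I0 ID IM] := hI.
have hL : is_ideal (fun c => exists n, top_coef I n c).
  split=> [|c d [m hc] [n hd]|c d [n hd]].
  - by exists 0, 0; rewrite size_poly0 coef0.
  - exists (maxn m n); have [_ LD _] := top_coef_ideal (maxn m n) hI.
    by apply: LD; [apply: top_coef_le hc|apply: top_coef_le hd];
      rewrite ?leq_maxl ?leq_maxr.
  - by exists n; have [_ _ LM] := top_coef_ideal n hI; apply: LM.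
have [cs [csI Ics]] := nR hL.
(* A common degree exists because [top_coef] grows with the degree and [cs] is finite. *)
have [N csN] : exists N, forall c, c \in cs -> top_coef I N c.
  elim: cs csI {Ics} => [|c cs IH] h; first by exists 0%N.
  have [m hc] := h c (mem_head _ _).
  have [d ds|n hn] := IH; first by apply: h; rewrite inE ds orbT.
  exists (maxn m n) => d; rewrite inE => /predU1P[->|/hn hd].
    by apply: top_coef_le hc; rewrite ?leq_maxl.
  by apply: top_coef_le hd; rewrite ?leq_maxr.
have [gs [gsI csgs]] := seq_lift csN.
have [s [sI Is]] := ideal_bounded_gen N hI.
exists (s ++ gs); split=> [g|f If J hJ sJ].
  by rewrite mem_cat => /orP[/sI //|/gsI[c _ []]].
have hIJ : is_ideal (fun g => J g /\ I g).
  have [J0 JD JM] := hJ.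
  by split=> // [x y [? ?] [? ?]|x y [? ?]]; split; auto.
suff: forall n f, I f -> (size f <= n)%N -> J f by apply; eauto.
elim=> [|n IH] {}f {}If sf.
  by move: sf; rewrite leqn0 size_poly_eq0 => /eqP ->; case: hJ.
(* Size at most [N] is settled by [s]; beyond that, the lifts [gs] shifted up to degree [n] cancel
   the top coefficient. *)
have [lt_nN|le_Nn] := ltnP n N.
  apply: (Is f If (leq_trans sf lt_nN)) => // g gs'.
  by apply: sJ; rewrite mem_cat gs'.
have [g [[Jg Ig] sg fg]] : top_coef (fun g => J g /\ I g) n f`_n.
  apply: top_coef_le le_Nn _ => //.
  apply: (Ics f`_n); first by exists n, f.
    exact: top_coef_ideal.
  move=> c /csgs[g ggs [Ig sg gc]]; exists g; split=> //; split=> //.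
  by apply: sJ; rewrite mem_cat ggs orbT.
rewrite -(subrK g f); have [_ JD _] := hJ; apply: JD => //.
by apply: IH; rewrite ?size_sub_top //; apply: idealB.
Qed.

End HilbertBasis.

Lemma mpoly_gen (R : comNzRingType) n (P : {mpoly R[n]} -> Prop) :
  (forall c, P c%:MP) -> (forall i, P 'X_i) ->
  (forall p q, P p -> P q -> P (p + q)) ->
  (forall p q, P p -> P q -> P (p * q)) -> forall p, P p.
Proof.
move=> PC PX PD PM p; rewrite (mpolyE p); elim/big_ind: _ => // [|m _].
  by rewrite -(mpolyC0 n R).
rewrite -mul_mpolyC; apply: (PM) => //; rewrite mpolyXE_id.
elim/big_ind: _ => // [|i _]; first exact: (PC 1).
by elim: (m i) => [|k IH]; [apply: (PC 1)|rewrite exprS; apply: PM].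
Qed.

Lemma mpoly_noetherian (R : comNzRingType) n :
  noetherian R -> noetherian {mpoly R[n]}.
Proof.
move=> nR; elim: n => [|n IH].
  apply: (@noetherian_image _ _ (@mpolyC 0 R)) nR => p.
  elim/mpoly_gen: p => [c|[]//|_ _ [c <-] [d <-]|_ _ [c <-] [d <-]].
  - by exists c.
  - by exists (c + d); rewrite rmorphD.
  - by exists (c * d); rewrite rmorphM.
pose f (p : {poly {mpoly R[n]}}) := (map_poly (@mwiden n R) p).['X_ord_max].
(* The surjection from R[x_1, ..., x_n][X] that sends X to the last variable. *)
pose fM : {rmorphism {poly {mpoly R[n]}} -> {mpoly R[n.+1]}} :=
  horner_eval ('X_ord_max : {mpoly R[n.+1]}) \o map_poly (@mwiden n R).
apply: (@noetherian_image _ _ fM) (poly_noetherian IH) => p.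
elim/mpoly_gen: p => [c|i|_ _ [p <-] [q <-]|_ _ [p <-] [q <-]].
- by exists (c%:MP)%:P; rewrite /= map_polyC /= horner_evalE hornerC mwidenC.
- have [j ->|->] := unliftP ord_max i.
    exists ('X_j)%:P; rewrite /= map_polyC /= horner_evalE hornerC mwidenX.
    rewrite mnmwiden1; congr ('X_ _); apply/val_inj.
    by rewrite /= /bump leqNgt ltn_ord.
  by exists 'X; rewrite /= map_polyX horner_evalE hornerX.
- by exists (p + q); rewrite rmorphD.
- by exists (p * q); rewrite rmorphM.
Qed.

(** * Polynomial algebras and quotients *)

Section AlgHomTheory.
Variables (C : pzRingType) (A B : pzAlgType C) (f : algHom A B).

Lemma hom0 : f 0 = 0.
Proof. by rewrite -(rmorph0 structmap) hom_structmap rmorph0. Qed.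

Lemma homN x : f (- x) = - f x.
Proof. by apply: (addIr (f x)); rewrite -homD !addNr hom0. Qed.

Lemma homB x y : f (x - y) = f x - f y.
Proof. by rewrite homD homN. Qed.

Lemma hom_sum I (s : seq I) (F : I -> A) :
  f (\sum_(i <- s) F i) = \sum_(i <- s) f (F i).
Proof. exact: (big_morph f (homD f) hom0). Qed.

End AlgHomTheory.

Section PolynomialAlgebra.
Variables (C : comPzRingType) (C_neq0 : 1 != 0 :> C) (k : nat).

Definition polyalg : Type := {mpoly (nonzero_ring C_neq0)[k]}.
HB.instance Definition _ := GRing.ComPzRing.copy polyalg
  {mpoly (nonzero_ring C_neq0)[k]}.

Let polyC (c : C) : polyalg := (c : nonzero_ring C_neq0)%:MP_[k].
Fact polyC_zmod : zmod_morphism polyC.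
Proof. by move=> c d; apply: mpolyCB. Qed.
Fact polyC_monoid : monoid_morphism polyC.
Proof. by split=> // c d; apply: mpolyCM. Qed.
Fact polyC_central c (p : polyalg) : polyC c * p = p * polyC c.
Proof. exact: mulrC. Qed.
HB.instance Definition _ := PzRing_isAlgebraOver.Build C polyalg
  polyC_zmod polyC_monoid polyC_central.

Definition polyvar (i : 'I_k) : polyalg := 'X_i.

Lemma polyalg_gen (P : polyalg -> Prop) :
  (forall c, P (structmap c)) -> (forall i, P (polyvar i)) ->
  (forall p q, P p -> P q -> P (p + q)) ->
  (forall p q, P p -> P q -> P (p * q)) -> forall p, P p.
Proof. exact: (@mpoly_gen (nonzero_ring C_neq0) k P). Qed.

Section Eval.
Variables (D : comPzAlgType C) (d : 'I_k -> D).

Section NonzeroTarget.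
Variable D_neq0 : 1 != 0 :> D.
Let phi (c : nonzero_ring C_neq0) : nonzero_ring D_neq0 := structmap (c : C).
Let phi_zmod : zmod_morphism phi.
Proof. exact: (@structmap_zmod_morphism C D). Qed.
Let phi_monoid : monoid_morphism phi.
Proof. exact: (@structmap_monoid_morphism C D). Qed.
HB.instance Definition _ := GRing.isZmodMorphism.Build _ _ phi phi_zmod.
HB.instance Definition _ := GRing.isMonoidMorphism.Build _ _ phi phi_monoid.

(** For nonzero D, evaluation is definitionally the library's [mmap], which brings the morphism
    laws. *)
Let eval_mmap p : mpoly_eval d p = mmap phi (d : 'I_k -> nonzero_ring D_neq0) p.
Proof. by []. Qed.

Let evalD_nz : {morph mpoly_eval d : p q / p + q :> polyalg >-> p + q}.
Proof. exact: (mmapD (d : 'I_k -> nonzero_ring D_neq0) phi). Qed.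
Let evalM_nz : {morph mpoly_eval d : p q / p * q :> polyalg >-> p * q}.
Proof.
exact: (mmap_is_multiplicative (d : 'I_k -> nonzero_ring D_neq0) phi).1.
Qed.
Let eval_structmap_nz c : mpoly_eval d (structmap c : polyalg) = structmap c.
Proof. exact: (mmapC (d : 'I_k -> nonzero_ring D_neq0) phi). Qed.
Let eval_var_nz i : mpoly_eval d (polyvar i) = d i.
Proof. by rewrite eval_mmap [LHS](mmapX _ phi) mmap1U. Qed.

Lemma mpoly_eval_nonzero :
  [/\ {morph mpoly_eval d : p q / p + q :> polyalg >-> p + q},
      {morph mpoly_eval d : p q / p * q :> polyalg >-> p * q},
      forall c, mpoly_eval d (structmap c : polyalg) = structmap c
    & forall i, mpoly_eval d (polyvar i) = d i].
Proof. by []. Qed.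
End NonzeroTarget.

(** In the zero ring any two elements are equal, so the laws also hold there. *)
Lemma mpoly_eval_axioms :
  [/\ {morph mpoly_eval d : p q / p + q :> polyalg >-> p + q},
      {morph mpoly_eval d : p q / p * q :> polyalg >-> p * q},
      forall c, mpoly_eval d (structmap c : polyalg) = structmap c
    & forall i, mpoly_eval d (polyvar i) = d i].
Proof.
have [D0|] := eqVneq (1 : D) 0; last exact: mpoly_eval_nonzero.
have D1 (x y : D) : x = y by rewrite -[x]mulr1 -[y]mulr1 D0 !mulr0.
by split=> [p q|p q|c|i]; apply: D1.
Qed.

Definition eval_hom : algHom polyalg D :=
  let: And4 eD eM eC _ := mpoly_eval_axioms in
  @AlgHom C polyalg D (mpoly_eval d) eD eM eC.

Lemma eval_homE p : eval_hom p = mpoly_eval d p.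
Proof. by rewrite /eval_hom; case: mpoly_eval_axioms. Qed.

Lemma eval_hom_var i : eval_hom (polyvar i) = d i.
Proof. by rewrite eval_homE; case: mpoly_eval_axioms. Qed.

End Eval.

Lemma polyalg_ext (D : pzAlgType C) (f g : algHom polyalg D) :
  (forall i, f (polyvar i) = g (polyvar i)) -> f =1 g.
Proof.
move=> fg; apply: polyalg_gen => [c|//|p q fp fq|p q fp fq].
- by rewrite !hom_structmap.
- by rewrite !homD fp fq.
- by rewrite !homM fp fq.
Qed.

End PolynomialAlgebra.

(** * Quotient of a commutative algebra by an ideal *)

Section QuotientAlgebra.
Variables (C : comPzRingType) (P : comPzAlgType C) (I : P -> Prop).
Hypothesis hI : is_ideal I.

Let I0 : I 0. Proof. by case: hI. Qed.
Let ID x y : I x -> I y -> I (x + y). Proof. by case: hI => _ + _; apply. Qed.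
Let IM x y : I y -> I (x * y). Proof. by case: hI => _ _; apply. Qed.
Let IN x : I x -> I (- x). Proof. by rewrite -mulN1r; apply: IM. Qed.

(** The proof that [I] is an ideal is an argument so that the type [quot hI] records it and the ring
    structure can be inferred from the type. *)
Definition quot_eqv of is_ideal I : rel P := fun x y => `[< I (x - y) >].

Fact quot_eqv_refl : reflexive (quot_eqv hI).
Proof. by move=> x; apply/asboolP; rewrite subrr. Qed.
Fact quot_eqv_sym : ssrbool.symmetric (quot_eqv hI).
Proof. by move=> x y; apply/asboolP/asboolP => /IN; rewrite opprB. Qed.
Fact quot_eqv_trans : transitive (quot_eqv hI).
Proof.
move=> y x z /asboolP h /asboolP k; apply/asboolP.
by have := ID h k; rewrite addrA subrK.
Qed.

Canonical quot_equiv :=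
  EquivRel (quot_eqv hI) quot_eqv_refl quot_eqv_sym quot_eqv_trans.

Definition quot := {eq_quot quot_equiv}.
HB.instance Definition _ := Choice.on quot.
HB.instance Definition _ := EqQuotient.on quot.

Definition quot_pi (x : P) : quot := \pi_quot x.

Lemma quot_piP x y : quot_pi x = quot_pi y <-> I (x - y).
Proof. by split=> [/eqquotP/asboolP //|h]; apply/eqquotP/asboolP. Qed.

Lemma quot_pi_surj (z : quot) : exists x, z = quot_pi x.
Proof. by exists (repr z); rewrite /quot_pi reprK. Qed.

Lemma quot_reprK x : I (repr (quot_pi x) - x).
Proof. by apply/quot_piP; rewrite /quot_pi reprK. Qed.

Definition quot_opp (z : quot) : quot := quot_pi (- repr z).
Definition quot_add (z w : quot) : quot := quot_pi (repr z + repr w).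
Definition quot_mul (z w : quot) : quot := quot_pi (repr z * repr w).

Let piN x : quot_opp (quot_pi x) = quot_pi (- x).
Proof. by apply/quot_piP; rewrite -opprD; apply/IN/quot_reprK. Qed.
Let piD x y : quot_add (quot_pi x) (quot_pi y) = quot_pi (x + y).
Proof.
by apply/quot_piP; rewrite opprD addrACA; apply: ID; apply: quot_reprK.
Qed.
Let piM x y : quot_mul (quot_pi x) (quot_pi y) = quot_pi (x * y).
Proof.
apply/quot_piP; set x' := repr _; set y' := repr _.
(* x'y' - xy = x'(y' - y) + (x' - x)y. *)
rewrite -[_ - _](subrKA (x' * y)) -mulrBr -mulrBl [(x' - x) * y]mulrC.
by apply: ID; apply/IM/quot_reprK.
Qed.

Fact quot_addA : associative quot_add.
Proof.
move=> z w v; have [x ->] := quot_pi_surj z; have [y ->] := quot_pi_surj w.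
by have [u ->] := quot_pi_surj v; rewrite !piD addrA.
Qed.
Fact quot_addC : commutative quot_add.
Proof. by move=> z w; rewrite /quot_add addrC. Qed.
Fact quot_add0 : left_id (quot_pi 0) quot_add.
Proof. by move=> z; have [x ->] := quot_pi_surj z; rewrite piD add0r. Qed.
Fact quot_addN : left_inverse (quot_pi 0) quot_opp quot_add.
Proof. by move=> z; have [x ->] := quot_pi_surj z; rewrite piN piD addNr. Qed.
HB.instance Definition _ :=
  GRing.isZmodule.Build quot quot_addA quot_addC quot_add0 quot_addN.

Fact quot_mulA : associative quot_mul.
Proof.
move=> z w v; have [x ->] := quot_pi_surj z; have [y ->] := quot_pi_surj w.
by have [u ->] := quot_pi_surj v; rewrite !piM mulrA.
Qed.
Fact quot_mulC : commutative quot_mul.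
Proof. by move=> z w; rewrite /quot_mul mulrC. Qed.
Fact quot_mul1 : left_id (quot_pi 1) quot_mul.
Proof. by move=> z; have [x ->] := quot_pi_surj z; rewrite piM mul1r. Qed.
Fact quot_mulDl : left_distributive quot_mul +%R.
Proof.
move=> z w v; have [x ->] := quot_pi_surj z; have [y ->] := quot_pi_surj w.
have [u ->] := quot_pi_surj v; rewrite -[_ + _]/(quot_add _ _).
by rewrite -[RHS]/(quot_add _ _) !(piM, piD) mulrDl.
Qed.
HB.instance Definition _ := GRing.Zmodule_isComPzRing.Build quot
  quot_mulA quot_mulC quot_mul1 quot_mulDl.

Lemma quot_piD : {morph quot_pi : x y / x + y}.
Proof. by move=> x y; rewrite -piD. Qed.
Lemma quot_piM : {morph quot_pi : x y / x * y}.
Proof. by move=> x y; rewrite -piM. Qed.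

Let qmap (c : C) : quot := quot_pi (structmap c).
Fact qmap_zmod : zmod_morphism qmap.
Proof.
by move=> c d; apply: (addIr (qmap d)); rewrite subrK -quot_piD -rmorphD subrK.
Qed.
Fact qmap_monoid : monoid_morphism qmap.
Proof. by split=> [|c d]; rewrite /qmap ?rmorph1 // rmorphM quot_piM. Qed.
Fact qmap_central c (x : quot) : qmap c * x = x * qmap c.
Proof. exact: mulrC. Qed.
HB.instance Definition _ := PzRing_isAlgebraOver.Build C quot
  qmap_zmod qmap_monoid qmap_central.

Definition quot_hom : algHom P quot :=
  @AlgHom C P quot quot_pi quot_piD quot_piM (fun=> erefl).

Lemma quot_hom_eq0 x : quot_hom x = 0 <-> I x.
Proof. by rewrite -[0]/(quot_pi 0) quot_piP subr0. Qed.

Lemma quot_lift (D : pzAlgType C) (f : algHom P D) :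
  (forall x, I x -> f x = 0) ->
  exists g : algHom quot D, algHom_comp g quot_hom =1 f.
Proof.
move=> fI; pose g (z : quot) := f (repr z).
have gpi x : g (quot_pi x) = f x.
  by apply/eqP; rewrite -subr_eq0 -homB fI //; apply: quot_reprK.
have gD : {morph g : z w / z + w}.
  move=> z w; have [x ->] := quot_pi_surj z; have [y ->] := quot_pi_surj w.
  by rewrite -quot_piD !gpi homD.
have gM : {morph g : z w / z * w}.
  move=> z w; have [x ->] := quot_pi_surj z; have [y ->] := quot_pi_surj w.
  by rewrite -quot_piM !gpi homM.
have gC c : g (structmap c) = structmap c by rewrite gpi hom_structmap.
by exists (AlgHom gD gM gC).
Qed.

End QuotientAlgebra.

Lemma quot_finitely_presented (C : comPzRingType) (C_neq0 : 1 != 0 :> C) k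
    (I : polyalg C_neq0 k -> Prop) (hI : is_ideal I) :
  noetherian (polyalg C_neq0 k) -> finitely_presented (quot hI).
Proof.
move=> nP C_neq0'; rewrite {C_neq0'}(bool_irrelevance C_neq0' C_neq0).
have [s [sI Is]] := nP I hI.
pose d i := quot_hom hI (polyvar C_neq0 i).
(* Both sides are algebra morphisms that agree on the variables, so the kernel of evaluation is
   [I]. *)
have evE p : mpoly_eval d p = quot_hom hI p.
  rewrite -eval_homE; apply: (polyalg_ext (g := quot_hom hI)) => i.
  exact: eval_hom_var.
exists k, d, (size s), (fun j => s`_j); split=> [z|p].
  by have [p ->] := quot_pi_surj z; exists p; rewrite evE.
rewrite evE quot_hom_eq0; split=> [/Is/ideal_gen_seq //|[q ->]].
have [I0 ID IM] := hI; elim/big_ind: _ => // j _.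
by apply: IM; apply/sI/mem_nth.
Qed.

(** * Generators, relations and coordinates *)

(** Terms stand in for noncommutative polynomials: a relation between generators is a pair of terms
    with the same value, and no free algebra has to be built. *)
Inductive alg_term (K I : Type) :=
| TermScalar of K
| TermVar of I
| TermAdd of alg_term K I & alg_term K I
| TermMul of alg_term K I & alg_term K I.
Arguments TermVar {K I}.
Arguments TermScalar {K I}.

Section Terms.
Variables (K : comPzRingType) (I : Type).
Implicit Types (e : alg_term K I).

Fixpoint term_val (B : pzAlgType K) (b : I -> B) e : B :=
  match e with
  | TermScalar c => structmap c
  | TermVar i => b i
  | TermAdd e1 e2 => term_val b e1 + term_val b e2
  | TermMul e1 e2 => term_val b e1 * term_val b e2
  end.

Lemma term_val_hom (B D : pzAlgType K) (f : algHom B D) (b : I -> B)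
    (d : I -> D) e :
  (forall i, f (b i) = d i) -> f (term_val b e) = term_val d e.
Proof.
move=> fb; elim: e => [c|i|e1 IH1 e2 IH2|e1 IH1 e2 IH2] //=.
- exact: hom_structmap.
- by rewrite homD IH1 IH2.
- by rewrite homM IH1 IH2.
Qed.

Variables (R : pzAlgType K) (r : I -> R).
Hypothesis r_gen : forall x, exists e, x = term_val r e.

Lemma gen_hom_ext (B : pzAlgType K) (f g : algHom R B) :
  (forall i, f (r i) = g (r i)) -> f = g.
Proof.
move=> fg; apply: algHomP => x; have [e ->] := r_gen x.
rewrite !(term_val_hom (d := f \o r)) // => i.
exact/esym/fg.
Qed.

(** Write [x] as the value of a chosen term and evaluate that term at [b]; the hypothesis on
    relations makes the result independent of the choice, hence a morphism. *)
Lemma gen_hom_exists (B : pzAlgType K) (b : I -> B) :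
  (forall e1 e2, term_val r e1 = term_val r e2 ->
     term_val b e1 = term_val b e2) ->
  exists f : algHom R B, forall i, f (r i) = b i.
Proof.
move=> b_rel; have [t rt] := choice r_gen.
pose f x := term_val b (t x).
have fE e : f (term_val r e) = term_val b e by apply: b_rel; rewrite -rt.
have fD : {morph f : x y / x + y}.
  by move=> x y; have := fE (TermAdd (t x) (t y)); rewrite /= -!rt.
have fM : {morph f : x y / x * y}.
  by move=> x y; have := fE (TermMul (t x) (t y)); rewrite /= -!rt.
exists (AlgHom fD fM (fun c => fE (TermScalar c))) => i.
exact: (fE (TermVar i)).
Qed.

End Terms.

Lemma finitely_generated_terms (K : comPzRingType) (R : pzAlgType K) :
  finitely_generated R -> exists m (r : 'I_m -> R),
    forall x, exists e : alg_term K 'I_m, x = term_val r e.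
Proof.
move=> [s s_gen]; exists (size s), (fun j => s`_j) => x.
apply: (s_gen (fun x => exists e : alg_term K 'I_(size s),
  x = term_val (fun j : 'I_(size s) => s`_j) e)) => [|y ys].
  split=> [c|_ _ [e1 ->] [e2 ->]|_ _ [e1 ->] [e2 ->]].
  - by exists (TermScalar c).
  - by exists (TermAdd e1 e2).
  - by exists (TermMul e1 e2).
have lt_ys : (index y s < size s)%N by rewrite index_mem.
by exists (TermVar (Ordinal lt_ys)); rewrite /= nth_index.
Qed.

(** Such an algebra is a quotient of a polynomial ring over [F]. *)
Lemma finitely_generated_noetherian (F : fieldType) (C : comPzAlgType F) :
  finitely_generated C -> noetherian C.
Proof.
move=> /finitely_generated_terms[m [c c_gen]].
have F_neq0 : 1 != 0 :> F := oner_neq0 F.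
pose f := eval_hom F_neq0 c.
have f_zmod : zmod_morphism f by move=> p q; apply: homB.
have f_monoid : monoid_morphism f by split; [apply: hom1|apply: homM].
pose fM : {rmorphism polyalg F_neq0 m -> C} := HB.pack (f : _ -> _)
  (GRing.isZmodMorphism.Build _ _ _ f_zmod)
  (GRing.isMonoidMorphism.Build _ _ _ f_monoid).
apply: (@noetherian_image _ _ fM) => [x|].
  have [e ->] := c_gen x; exists (term_val (fun i => polyvar F_neq0 i) e).
  by apply: term_val_hom => i; apply: eval_hom_var.
apply: (@mpoly_noetherian (nonzero_ring F_neq0)).
exact: field_noetherian.
Qed.

Lemma dual_basis (C : comPzRingType) (M : lmodType C) :
  module_finite M -> projective M ->
  exists N (a : 'I_N -> M) (f : 'I_N -> M -> C),
    (forall i, {morph f i : x y / x + y}) /\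
    (forall i c x, f i (c *: x) = c * f i x) /\
    forall x, x = \sum_i f i x *: a i.
Proof.
move=> [N [a a_gen]] M_proj.
pose g (v : 'rV[C]_N) : M := \sum_i v 0 i *: a i.
have g_lin : linear g.
  move=> c v w; rewrite scaler_sumr -big_split; apply: eq_bigr => i _.
  by rewrite !mxE scalerDl scalerA.
pose gL : {linear 'rV[C]_N -> M} := HB.pack g
  (GRing.isLinear.Build _ _ _ _ g g_lin).
have g_surj x : exists v, gL v = x.
  have [c ->] := a_gen x; exists (\row_i c i).
  by apply: eq_bigr => i _; rewrite mxE.
(* Lifting the identity of [M] through [gL] gives a linear section [h], whose entries are the dual
   functionals. *)
have [h gh] := M_proj _ _ gL (GRing.Linear.clone _ _ _ _ (@idfun M) _) g_surj.
exists N, a, (fun i x => h x 0 i); split=> [i x y|].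
  by rewrite linearD mxE.
split=> [i c x|x]; first by rewrite linearZ mxE.
exact: (esym (gh x)).
Qed.

(** * Coordinates on A (x) D with respect to a dual basis of A *)

Section Coordinates.
Variables (C : comPzRingType) (A : pzAlgType C) (N : nat).
Variables (a : 'I_N -> A) (f : 'I_N -> A -> C).
Hypothesis fD : forall i, {morph f i : x y / x + y}.
Hypothesis fZ : forall i c x, f i (structmap c * x) = c * f i x.
Hypothesis a_f : forall x, x = \sum_i structmap (f i x) * a i.

Section Target.
Variable D : pzAlgType C.

Lemma balanced_coord i :
  balanced (fun (x : A) (d : D) => structmap (f i x) * d).
Proof.
split=> [d x y|x d d'|c x d].
- by rewrite fD rmorphD mulrDl.
- by rewrite mulrDr.
- by rewrite fZ mulrC rmorphM mulrA.
Qed.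

(** This is f_i (x) id, with C (x) D identified with D. *)
Definition dual_coord i (t : tensor A D) : D :=
  tens_lift (fun x d => structmap (f i x) * d) t.

Lemma dual_coord0 i : dual_coord i 0 = 0.
Proof. exact: tens_lift0 (balanced_coord i). Qed.
Lemma dual_coordD i : {morph dual_coord i : t u / t + u}.
Proof. exact: tens_liftD (balanced_coord i). Qed.
Lemma dual_coord_tens i x d : dual_coord i (tens x d) = structmap (f i x) * d.
Proof. exact: tens_lift_tens (balanced_coord i) _ _. Qed.

Lemma tens0r (x : A) : tens x 0 = 0 :> tensor A D.
Proof. by apply: (addrI (tens x 0)); rewrite -tensDr !addr0. Qed.
Lemma tens0l (d : D) : tens 0 d = 0 :> tensor A D.
Proof. by apply: (addrI (tens 0 d)); rewrite -tensDl !addr0. Qed.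

(** On a pure tensor, expand the left factor in the dual basis and move the scalars across the
    tensor sign. *)
Lemma tens_coord (t : tensor A D) : t = \sum_i tens (a i) (dual_coord i t).
Proof.
elim/tens_ind: t => [|x d t IH].
  by rewrite big1 // => i _; rewrite dual_coord0 tens0r.
rewrite {1}IH; under [RHS]eq_bigr => i _ do rewrite dual_coordD tensDr.
rewrite big_split /=; congr (_ + _); rewrite {1}(a_f x).
rewrite (big_morph (fun y => tens y d) (fun y z => tensDl y z d) (tens0l d)).
by apply: eq_bigr => i _; rewrite dual_coord_tens tensZ.
Qed.

Lemma dual_coord_inj (t u : tensor A D) :
  (forall i, dual_coord i t = dual_coord i u) -> t = u.
Proof.
move=> tu; rewrite (tens_coord t) (tens_coord u).
by apply: eq_bigr => i _; rewrite tu.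
Qed.

End Target.

Lemma dual_coord_map (D E : pzAlgType C) (g : algHom D E) i (t : tensor A D) :
  dual_coord i (tens_hom A g t) = g (dual_coord i t).
Proof.
elim/tens_ind: t => [|x d t IH]; first by rewrite !(hom0, dual_coord0).
rewrite homD !dual_coordD homD IH; congr (_ + _).
by rewrite /= tens_map_tens !dual_coord_tens homM hom_structmap.
Qed.

End Coordinates.

Lemma surj_inj_bij (T U : Type) (g : T -> U) :
  injective g -> (forall y, exists x, g x = y) -> bijective g.
Proof.
move=> g_inj g_surj; have [h gh] := choice g_surj.
by exists h => // x; apply: g_inj; rewrite gh.
Qed.

(* Yoneda: naturality is automatic for a family induced by a point phi. *)
Lemma represents_universal (K : comPzRingType) (C : comPzAlgType K)
    (A : pzAlgType C) (R : pzAlgType K) (X : affine C) (phi : Rep_obj A R X) :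
  (forall Z (psi : Rep_obj A R Z),
     exists f : affineHom Z X, Rep_map f phi = psi) ->
  (forall Z (f g : affineHom Z X), Rep_map f phi = Rep_map g phi -> f = g) ->
  represents X (Rep A R).
Proof.
move=> phi_surj phi_inj; exists (fun Z f => Rep_map f phi); split=> [Z|Z Y f g].
  by apply: surj_inj_bij; [apply: phi_inj|apply: phi_surj].
exact: Rep_map_comp.
Qed.

(** * The representing scheme *)

(* {mpoly _[_]} needs a nonzero coefficient ring, hence a separate treatment *)
(* of C = 0, for which every functor value and every hom set is a singleton. *)
Section ZeroRing.
Variables (K : comPzRingType) (C : comPzAlgType K).
Hypothesis C0 : 1 = 0 :> C.

Definition regular_alg : Type := C.
HB.instance Definition _ := GRing.ComPzRing.copy regular_alg C.
Let idC (c : C) : regular_alg := c.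
Fact idC_zmod : zmod_morphism idC. Proof. by []. Qed.
Fact idC_monoid : monoid_morphism idC. Proof. by []. Qed.
Fact idC_central c (x : regular_alg) : idC c * x = x * idC c.
Proof. exact: mulrC. Qed.
HB.instance Definition _ := PzRing_isAlgebraOver.Build C regular_alg
  idC_zmod idC_monoid idC_central.

Lemma zero_ring_alg (B : pzAlgType C) (x y : B) : x = y.
Proof.
have B0 : 1 = 0 :> B by rewrite -(rmorph1 structmap) C0 rmorph0.
by rewrite -[x]mulr1 -[y]mulr1 B0 !mulr0.
Qed.

Lemma zero_ring_fp : finitely_presented regular_alg.
Proof. by move=> C_neq0; case/negP: (C_neq0); apply/eqP. Qed.

Lemma zero_ring_represents (A : pzAlgType C) (R : pzAlgType K) :
  represents (Affine zero_ring_fp) (Rep A R).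
Proof.
pose zero_hom (Z : affine C) : Rep_obj A R Z := @AlgHom K R
  (restrict_scalars (tensor A 'O(Z))) (fun=> 0) (fun _ _ => zero_ring_alg _ _)
  (fun _ _ => zero_ring_alg _ _) (fun _ => zero_ring_alg _ _).
apply: (represents_universal (phi := zero_hom _)) => [Z psi|Z f g _].
  pose f : affineHom Z (Affine zero_ring_fp) := @AlgHom C regular_alg
    'O(Z) (fun=> 0) (fun _ _ => zero_ring_alg _ _)
    (fun _ _ => zero_ring_alg _ _) (fun _ => zero_ring_alg _ _).
  by exists f; apply: algHomP => x; apply: (@zero_ring_alg (tensor A 'O(Z))).
by apply: algHomP => x; apply: zero_ring_alg.
Qed.

End ZeroRing.

(** * The universal point and its universal property *)

Section Representation.
Variables (K : comPzRingType) (C : comPzAlgType K) (C_neq0 : 1 != 0 :> C).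
Hypothesis C_noetherian : noetherian C.
Variables (A : pzAlgType C) (N : nat) (a : 'I_N -> A) (f : 'I_N -> A -> C).
Hypothesis fD : forall i, {morph f i : x y / x + y}.
Hypothesis fZ : forall i c x, f i (structmap c * x) = c * f i x.
Hypothesis a_f : forall x, x = \sum_i structmap (f i x) * a i.
Variables (R : pzAlgType K) (m : nat) (r : 'I_m -> R).
Hypothesis r_gen : forall x, exists e : alg_term K 'I_m, x = term_val r e.

Local Notation P := (polyalg C_neq0 (m * N)).
Local Notation x_ j i := (polyvar C_neq0 (mxvec_index j i)).
Local Notation tensK B := (restrict_scalars (tensor A B)).

Definition generic_point (j : 'I_m) : tensK P := \sum_i tens (a i) (x_ j i).

(** Since the [a i] need not be linearly independent, the coordinates of [generic_point j] are the
    combinations sum_l f_i(a_l) x_jl rather than x_ji. [RepCoord] identifies the two, that is, it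
    forces each row into the summand A of C^N; uniqueness of the classifying map rests on it. *)
Inductive rep_equation : P -> Prop :=
| RepRelation i e1 e2 : term_val r e1 = term_val r e2 ->
    rep_equation (dual_coord f i (term_val generic_point e1)
                - dual_coord f i (term_val generic_point e2))
| RepCoord i j : rep_equation (dual_coord f i (generic_point j) - x_ j i).

Definition rep_ideal := ideal_gen rep_equation.
Let hI : is_ideal rep_ideal := ideal_gen_ideal rep_equation.
Local Notation D := (quot hI).

Lemma rep_ring_fp : finitely_presented D.
Proof.
apply: quot_finitely_presented.
apply: (@mpoly_noetherian (nonzero_ring C_neq0)).
exact: C_noetherian.
Qed.

Let X := Affine rep_ring_fp.
Let pi : algHom P D := quot_hom hI.

Lemma pi_eq p q : rep_ideal (p - q) -> pi p = pi q.
Proof. by move=> h; apply/quot_piP. Qed.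

Let pi_point (j : 'I_m) : tensK D := tens_hom A pi (generic_point j).

(** Equality in A (x) D is tested on coordinates, where it is the image under [pi] of a
    [RepRelation] equation. *)
Lemma pi_point_relation e1 e2 : term_val r e1 = term_val r e2 ->
  term_val pi_point e1 = term_val pi_point e2.
Proof.
move=> r12; pose h := restrict_hom (tens_hom A pi).
have hE e : h (term_val generic_point e) = term_val pi_point e.
  exact: term_val_hom.
rewrite -!hE; apply: (dual_coord_inj fD fZ a_f) => i.
rewrite !(dual_coord_map fD fZ); apply: pi_eq.
by apply: ideal_gen_sub; apply: RepRelation.
Qed.

Lemma coord_pi_point i j : dual_coord f i (pi_point j) = pi (x_ j i).
Proof.
rewrite (dual_coord_map fD fZ); apply: pi_eq.
by apply: ideal_gen_sub; apply: RepCoord.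
Qed.

Lemma rep_represents : represents X (Rep A R).
Proof.
have [phi phi_r] := gen_hom_exists r_gen pi_point_relation.
apply: (represents_universal (X := X) (phi := phi)) => [Z psi|Z g g' eq_gg'].
  (* The coordinate matrix of [psi] on the generators, flattened by inverting [mxvec_index]. *)
  pose d k := let j := (enum_val (cast_ord (esym (mxvec_cast m N)) k)) in
    dual_coord f j.2 (psi (r j.1)).
  have d_idx j i : d (mxvec_index j i) = dual_coord f i (psi (r j)).
    by rewrite /d cast_ordK enum_rankK.
  pose ev := eval_hom C_neq0 d.
  have ev_x j i : ev (x_ j i) = dual_coord f i (psi (r j)).
    by rewrite /ev eval_hom_var d_idx.
  have ev_point j : tens_hom A ev (generic_point j) = psi (r j).
    rewrite hom_sum [RHS](tens_coord fD fZ a_f); apply: eq_bigr => i _.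
    by rewrite /= tens_map_tens ev_x.
  have ev_term e : tens_hom A ev (term_val generic_point e) =
      psi (term_val r e).
    rewrite (term_val_hom (f := psi) (d := psi \o r)) //.
    exact: (term_val_hom (f := restrict_hom (tens_hom A ev))).
  (* The kernel of [ev] is an ideal, so it suffices to kill the equations: relations hold because
     [psi] is defined on R, and [RepCoord] holds because [ev] takes x_ji to an actual coordinate of
     [psi (r j)]. *)
  have ev_eq p : rep_ideal p -> ev p = 0.
    move=> /(_ (fun p => ev p = 0)); apply.
      split=> [|x y evx evy|x y evy]; first exact: hom0.
        by rewrite homD evx evy addr0.
      by rewrite homM evy mulr0.
    move=> _ [i e1 e2 r12|i j]; rewrite homB -(dual_coord_map fD fZ).
      by rewrite -(dual_coord_map fD fZ) !ev_term r12 subrr.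
    by rewrite ev_point ev_x subrr.
  have [g g_pi] := quot_lift hI ev_eq.
  exists g; apply: (gen_hom_ext r_gen) => j.
  rewrite /= phi_r -ev_point; apply: (dual_coord_inj fD fZ a_f) => i.
  by rewrite !(dual_coord_map fD fZ); apply: g_pi.
(* Uniqueness: modulo the ideal each variable is a coordinate of the universal point, so its images
   under [g] and [g'] are coordinates of the same point over Z. *)
have eq_pi : algHom_comp g pi =1 algHom_comp g' pi.
  apply: polyalg_ext => k; case/mxvec_indexP: k => j i.
  rewrite -[LHS]/(g (pi _)) -[RHS]/(g' (pi _)) -coord_pi_point.
  rewrite -!(dual_coord_map fD fZ) -phi_r.
  by have := congr1 (fun h : Rep_obj A R Z => h (r j)) eq_gg' => /= ->.
apply: algHomP => z; have [p ->] := quot_pi_surj z; exact: eq_pi.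
Qed.

End Representation.

Theorem theorem5p7 (K : realType) (C : comPzAlgType K[i])
    (hC : finitely_generated C) (n : nat) (A : pzAlgType C)
    (hA : azumaya A n) (R : pzAlgType K[i]) (hR : finitely_generated R) :
  exists X : affine C, represents X (Rep A R).
Proof.
have [C0|C_neq0] := eqVneq (1 : C) 0.
  by exists (Affine (zero_ring_fp C0)); apply: zero_ring_represents.
have C_noeth := finitely_generated_noetherian hC.
have [A_fin A_proj _ _] := hA.
have [N [a [f [fD [fZ a_f]]]]] := dual_basis A_fin A_proj.
have [m [r r_gen]] := finitely_generated_terms hR.
eexists; exact: (rep_represents C_neq0 C_noeth fD fZ a_f r_gen).
Qed.
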